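(* Let $2\le t\le n$, let $L_n$ be the (directed) line on vertex set $\{1,\ldots,n\}$, and let $I_t(L_n)\subset k[x_1,\ldots,x_n]$ be its path ideal of length $t$, where $k$ is a field. Then $I_t(L_n)$ has a linear resolution if and only if $t\ge \frac{n}{2}$.
   Context: $L_n$ has edges $1\to2\to\cdots\to n$. The path ideal $I_t(L_n)$ is generated by the monomials $\prod_{j=1}^{t}x_{i_j}$ over all sequences $i_1,\ldots,i_t$ of distinct vertices with a directed edge from $i_j$ to $i_{j+1}$ for $1\le j\le t-1$; that is, $I_t(L_n)=\langle x_ix_{i+1}\cdots x_{i+t-1} : 1\le i\le n-t+1\rangle$. An ideal $I$ generated in degree $d$ in $S=k[x_1,\ldots,x_n]$ has a linear resolution if its minimal graded free resolution is $0\to S(-d-p)^{\beta_p}\to\cdots\to S(-d-1)^{\beta_1}\to S(-d)^{\beta_0}\to I\to 0$. *)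

(* Defs.v *)
From HB Require Import structures.
From mathcomp Require Import all_boot all_order all_algebra.
From mathcomp Require Export mpoly.

Set Implicit Arguments.
Unset Strict Implicit.
Unset Printing Implicit Defensive.

Import GRing.Theory.
Local Open Scope ring_scope.

(* Ideals are Prop-valued predicates: membership in an ideal of
   {mpoly k[n]} has no boolean decision procedure in the library. *)
Definition ideal_span (R : comNzRingType) (G : R -> Prop) (f : R) : Prop :=
  exists (m : nat) (c g : 'I_m -> R),
    (forall j, G (g j)) /\ f = \sum_(j < m) c j * g j.

Definition generated_in_degree (k : fieldType) (n d : nat)
    (I : {mpoly k[n]} -> Prop) : Prop :=
  exists G : {mpoly k[n]} -> Prop,
    (forall g, G g -> g \is d.-homog) /\ (forall f, I f <-> ideal_span G f).

(* The row vectors 'rV_r stand for the graded free module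
   S(-a_0) (+) ... (+) S(-a_(r-1)), whose degree m piece has j-th component
   S_(m - a_j), this being 0 when m < a_j. *)
Definition in_degree (k : fieldType) (n r : nat) (a : 'I_r -> nat) (m : nat)
    (u : 'rV[{mpoly k[n]}]_r) : Prop :=
  forall j, if (a j <= m)%N then u ord0 j \is (m - a j).-homog
            else u ord0 j == 0.

(* Matrices act on row vectors from the right. *)
Definition graded_map (k : fieldType) (n r s : nat)
    (a : 'I_r -> nat) (b : 'I_s -> nat) (D : 'M[{mpoly k[n]}]_(r, s)) : Prop :=
  forall m u, in_degree a m u -> in_degree b m (u *m D).

(* A minimal graded free resolution ... -> F_1 -> F_0 -> I -> 0 of finite
   length, where F_i is the sum of the S(-(mgr_shift i j)), j < mgr_rank i.
   Since mgr_rank i = 0 beyond the length p, exactness at F_p says that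
   F_p -> F_(p-1) is injective.  The augmentation is seen as a map to S = S(-0)
   with image I.  Minimality is im(F_(i+1) -> F_i) \subset (x_1, ..., x_n) F_i,
   i.e. the matrix entries have no constant term. *)
Record min_graded_res (k : fieldType) (n : nat) (I : {mpoly k[n]} -> Prop) :=
  MinGradedRes {
    mgr_length : nat;
    mgr_rank : nat -> nat;
    mgr_shift : forall i, 'I_(mgr_rank i) -> nat;
    mgr_diff : forall i, 'M[{mpoly k[n]}]_(mgr_rank i.+1, mgr_rank i);
    mgr_aug : 'M[{mpoly k[n]}]_(mgr_rank 0, 1);
    mgr_finite : forall i, (mgr_length < i)%N -> mgr_rank i = 0%N;
    mgr_diff_graded : forall i,
      graded_map (@mgr_shift i.+1) (@mgr_shift i) (mgr_diff i);
    mgr_aug_graded : graded_map (@mgr_shift 0) (fun=> 0%N) mgr_aug;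
    mgr_aug_image : forall f,
      I f <-> exists u : 'rV_(mgr_rank 0), u *m mgr_aug = f%:M;
    mgr_exact0 : forall u : 'rV_(mgr_rank 0),
      u *m mgr_aug = 0 <-> exists w, u = w *m mgr_diff 0;
    mgr_exact : forall i (u : 'rV_(mgr_rank i.+1)),
      u *m mgr_diff i = 0 <-> exists w, u = w *m mgr_diff i.+1;
    mgr_minimal : forall i (j : 'I_(mgr_rank i.+1)) (l : 'I_(mgr_rank i)),
      (mgr_diff i j l)@_0%MM = 0
  }.

Definition has_linear_resolution (k : fieldType) (n : nat)
    (I : {mpoly k[n]} -> Prop) : Prop :=
  exists d : nat, generated_in_degree d I /\
    exists F : min_graded_res I,
      forall i (j : 'I_(mgr_rank F i)), mgr_shift j = (d + i)%N.

(* The length t of a path is its number of vertices. *)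
Definition path_monomial (k : fieldType) (n : nat) (e : rel 'I_n) (t : nat)
    (f : {mpoly k[n]}) : Prop :=
  exists s : t.-tuple 'I_n,
    [/\ uniq s, sorted e s & f = \prod_(i <- s) 'X_i].

Definition path_ideal (k : fieldType) (n : nat) (e : rel 'I_n) (t : nat) :
    {mpoly k[n]} -> Prop :=
  ideal_span (@path_monomial k n e t).

(* Vertex i of the paper is the ordinal i - 1. *)
Definition line_edge (n : nat) : rel 'I_n :=
  fun i j => (j : nat) == i.+1.

(* Main.v *)
Require Import Defs.
From mathcomp Require Import all_boot all_order all_algebra.
From mathcomp Require Import mpoly zify.

(** The ideal is generated by the windows m_i = x_i ... x_(i+t-1), for
    0 <= i <= s, where s = n - t, and the condition on t says s <= t.

    If s <= t, all windows pairwise meet or abut.  The linear syzygies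
    x_i m_(i+1) = x_(i+t) m_i (the two sides are the word P_i of length t + 1
    starting at i) form an s x (s+1) matrix, and the claim is that they resolve
    the ideal in one step.  Everything is read off the tail sums
    T_p(z) = sum_(i >= p) z_i m_i, which determine z: the combination of the
    syzygies with coefficients w has T_(r+1) = w_r P_r ([tail_sum_syzygy]), so w
    is determined by it, and a syzygy z of the windows comes from the syzygy
    matrix as soon as each P_r divides T_(r+1)(z).  Now a monomial in T_(r+1)(z)
    is a multiple of some window starting after r, and, since
    T_(r+1)(z) = - sum_(i <= r) z_i m_i, also of one starting at or before r.
    Because s <= t the union of these two windows has no gap, so it contains the
    word P_r ([tail_sum_dvd]).

    If 2t < n, the windows M0 = x_0 ... x_(t-1) and M1 = x_(t+1) ... x_(2t)
    exist, and x_t separates them.  Their Koszul syzygy has degree 2t > t + 1 and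
    is not a consequence of linear ones: no third window divides M0 M1.  To see
    this for an arbitrary linear resolution, with generators f_j and linear first
    syzygies D, write M0 = sum u_j f_j and M1 = sum v_j f_j.  Then
    y = M1 u - M0 v is a syzygy, so y = w D.  Let c_j be the coefficient of M0 in
    f_j.  The linear forms D c involve no variable of M1
    ([linear_mcoeff_first]), hence the coefficient of M1 in y c = w (D c) is 0.
    But it is also the coefficient of M0 in sum u_j f_j = M0, that is 1. *)

Set Implicit Arguments.
Unset Strict Implicit.
Unset Printing Implicit Defensive.
Import Order.TTheory GRing.Theory Num.Theory.
Local Open Scope ring_scope.

(** * Coefficients of products and multiples of monomials *)

Section Coefficients.
Variables (k : fieldType) (n : nat).
Implicit Types (p q f : {mpoly k[n]}) (m a b : 'X_{1..n}).

Lemma mcoeffM_neq0 p q m : (p * q)@_m != 0 ->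
  exists a b, [/\ m = (a + b)%MM, p@_a != 0 & q@_b != 0].
Proof.
rewrite -mcoeff_msupp => /msuppM_le /allpairsP [[a b] /= [ha hb ->]].
by exists a, b; rewrite -!mcoeff_msupp.
Qed.

Lemma mcoeff_sum_neq0 (I : finType) (P : pred I) (F : I -> {mpoly k[n]}) m :
  (\sum_(i | P i) F i)@_m != 0 -> exists2 i, P i & (F i)@_m != 0.
Proof.
rewrite raddf_sum /= => nz.
case: (pickP [pred i | P i && ((F i)@_m != 0)]) => [i /andP[]|F0].
  by exists i.
by case/eqP: nz; apply: big1 => i Pi; move: (F0 i); rewrite /= Pi => /negbFE/eqP.
Qed.

(** A product coefficient to which only one pair of monomials contributes.  The
    hypothesis constrains the first factor only, as it determines the second. *)
Lemma mcoeffM_unique p q a b :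
    (forall a' b', (a + b = a' + b')%MM -> p@_a' != 0 -> q@_b' != 0 -> a' = a) ->
  (p * q)@_(a + b) = p@_a * q@_b.
Proof.
move=> uniq_a; set p' := p - p@_a *: 'X_[a].
have {1}-> : p = p@_a *: 'X_[a] + p' by rewrite addrC subrK.
have p'a : p'@_a = 0 by rewrite mcoeffB mcoeffZ mcoeffX eqxx mulr1 subrr.
rewrite mulrDl mcoeffD -scalerAl mcoeffZ.
rewrite -(commr_mpolyX a q) mcoeffMX.
case: (eqVneq (p' * q)@_(a + b) 0) => [->|]; first by rewrite addr0.
case/mcoeffM_neq0=> a' [b' [e pa' qb']].
have ne : a' != a by apply: contraNneq pa' => ->; rewrite p'a.
case/eqP: (ne); apply: (uniq_a _ b') => //.
move: pa'; rewrite mcoeffB mcoeffZ mcoeffX (eq_sym a) (negbTE ne).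
by rewrite mulr0 subr0.
Qed.

Lemma mpolyX_dvd f m :
  (forall a, f@_a != 0 -> (m <= a)%MM) -> exists q, f = q * 'X_[m].
Proof.
move=> le_m; exists (\sum_(a <- msupp f) f@_a *: 'X_[a - m]).
rewrite {1}[f]mpolyE mulr_suml; apply: eq_big_seq => a.
by rewrite mcoeff_msupp => /le_m le; rewrite -scalerAl -mpolyXD submK.
Qed.

Lemma mcoeffMX_neq0 p m a : (p * 'X_[m])@_a != 0 -> (m <= a)%MM.
Proof.
case/mcoeffM_neq0=> b [c [-> _]]; rewrite mcoeffX.
by case: (eqVneq m c) => [<- _|_]; [exact: lem_addl | rewrite eqxx].
Qed.

Lemma mpolyX_neq0 m : 'X_[m] != 0 :> {mpoly k[n]}.
Proof.
apply/eqP=> /(congr1 (mcoeff m)); rewrite mcoeffX eqxx mcoeff0.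
by apply/eqP; rewrite oner_eq0.
Qed.

End Coefficients.

(** * Homogeneous polynomials and graded maps *)

Section Homogeneous.
Variables (k : fieldType) (n : nat).
Implicit Types (p q f : {mpoly k[n]}) (m a b : 'X_{1..n}).

Lemma dhomog_mdeg d f m : f \is d.-homog -> f@_m != 0 -> mdeg m = d.
Proof. by move=> /dhomogP f_homog; rewrite -mcoeff_msupp => /f_homog. Qed.

Lemma mcoeffM_lowest d p f m : f \is d.-homog -> mdeg m = d ->
  (p * f)@_m = p@_0%MM * f@_m.
Proof.
move=> f_homog deg_m; rewrite -[m in LHS]add0m; apply: mcoeffM_unique => a b e _ fb.
apply/eqP; rewrite -mdeg_eq0; move/(congr1 (@mdeg n)): e.
by rewrite add0m mdegD deg_m (dhomog_mdeg f_homog fb); lia.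
Qed.

(** The i-th row of a matrix is the image of the i-th basis vector, which has
    degree [a i]. *)
Lemma graded_map_entry r s (a : 'I_r -> nat) (b : 'I_s -> nat)
    (D : 'M[{mpoly k[n]}]_(r, s)) i j c :
  graded_map a b D -> a i = (b j + c)%N -> D i j \is c.-homog.
Proof.
move=> gD a_i; have delta_deg : in_degree a (a i) (delta_mx ord0 i : 'rV[{mpoly k[n]}]_r).
  move=> l; rewrite mxE eqxx /=; case: (eqVneq l i) => [->|_].
    by rewrite leqnn subnn dhomog1.
  by rewrite dhomog0 eqxx if_same.
by have := gD _ _ delta_deg j; rewrite -rowE mxE a_i leq_addr addKn.
Qed.

Lemma homog_graded_map r s (a b c : nat) (D : 'M[{mpoly k[n]}]_(r, s)) :
    a = (b + c)%N -> (forall i j, D i j \is c.-homog) ->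
  graded_map (fun=> a) (fun=> b) D.
Proof.
move=> -> D_homog m u u_deg j; rewrite mxE.
have [le_m|lt_m] := leqP (b + c) m.
  rewrite (leq_trans (leq_addr c b) le_m); apply: rpred_sum => i _.
  have -> : (m - b = (m - (b + c)) + c)%N by lia.
  by apply: dhomogM; [move: (u_deg i); rewrite le_m | exact: D_homog].
rewrite big1 ?rpred0 ?eqxx ?if_same // => i _.
by move: (u_deg i); rewrite leqNgt lt_m /= => /eqP ->; rewrite mul0r.
Qed.

End Homogeneous.

(** * Squarefree monomials supported on intervals *)

Section Intervals.
Variable n : nat.
Implicit Types a b c : nat.

Definition interval_mnm a b : 'X_{1..n} := [multinom nat_of_bool (a <= i < b)%N | i < n].

Lemma interval_mnmE a b i : interval_mnm a b i = (a <= i < b)%N.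
Proof. exact: mnmE. Qed.

Lemma interval_mnm_cat a b c : (a <= b <= c)%N ->
  interval_mnm a c = (interval_mnm a b + interval_mnm b c)%MM.
Proof. by move=> h; apply/mnmP=> i; rewrite mnmDE !interval_mnmE; lia. Qed.

Lemma interval_mnm1 (i : 'I_n) : interval_mnm i i.+1 = U_(i)%MM.
Proof.
apply/mnmP=> j; rewrite mnm1E interval_mnmE ltnS -eqn_leq.
by congr nat_of_bool; apply/eqP/eqP => [/val_inj|->].
Qed.

Lemma mdeg_interval a b : (a <= b <= n)%N -> mdeg (interval_mnm a b) = (b - a)%N.
Proof.
elim: b => [|b IHb] /andP[le_ab lt_bn].
  rewrite sub0n; apply/eqP; rewrite mdeg_eq0; apply/eqP/mnmP=> i.
  by rewrite interval_mnmE mnm0E ltn0 andbF.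
have [eq_a|ne_a] := eqVneq a b.+1.
  rewrite eq_a subnn; apply/eqP; rewrite mdeg_eq0; apply/eqP/mnmP=> i.
  by rewrite interval_mnmE mnm0E; lia.
rewrite (@interval_mnm_cat a b b.+1) ?mdegD ?IHb; try lia.
by rewrite (interval_mnm1 (Ordinal lt_bn)) mdeg1; lia.
Qed.

End Intervals.

(** * The path ideal of a line as a monomial ideal *)

Section PathIdeal.
Variables (k : fieldType) (n t : nat).
Hypothesis t_gt0 : (0 < t)%N.

Local Notation window q := (interval_mnm n q (q + t)).

Lemma line_path_monomial (x : 'I_n) (s : seq 'I_n) : path (@line_edge n) x s ->
  (x + size s < n)%N /\
  \prod_(i <- x :: s) 'X_i = 'X_[k, interval_mnm n x (x + (size s).+1)].
Proof.
elim: s x => [|y s IHs] x /=.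
  by rewrite big_seq1 addn0 addn1 interval_mnm1.
case/andP=> /eqP y_eq /IHs [lt_n prod_eq]; split; first by lia.
rewrite big_cons prod_eq -interval_mnm1 -mpolyXD y_eq -interval_mnm_cat ?addSnnS //.
by lia.
Qed.

Lemma line_path_exists (x : 'I_n) r : (x + r < n)%N ->
  exists2 s, size s = r & path (@line_edge n) x s.
Proof.
elim: r x => [|r IHr] x lt_n; first by exists [::].
have lt_x1 : (x.+1 < n)%N by lia.
have [|s <- path_s] := IHr (Ordinal lt_x1); first by rewrite /= addSnnS.
by exists (Ordinal lt_x1 :: s) => //=; rewrite /line_edge eqxx.
Qed.

Lemma path_monomial_lineE (f : {mpoly k[n]}) :
  path_monomial (@line_edge n) t f <->
  exists2 q, (q + t <= n)%N & f = 'X_[window q].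
Proof.
split=> [[[[|x s] /= /eqP sz] [_ path_s ->]]|[q q_n ->]].
- by move: t_gt0; rewrite -sz.
- have [lt_n ->] := line_path_monomial path_s.
  by exists x; rewrite -sz //= addnS.
have q_lt : (q < n)%N by lia.
have [|s sz path_s] := @line_path_exists (Ordinal q_lt) t.-1; first by move=> /=; lia.
have sz_t : size (Ordinal q_lt :: s) == t by rewrite /= sz prednK.
exists (Tuple sz_t); split=> //.
  rewrite -(map_inj_uniq val_inj).
  apply: (sorted_uniq ltn_trans ltnn); rewrite sorted_map.
  by apply: sub_path path_s => i j /eqP /= ->; apply: ltnSn.
by rewrite (line_path_monomial path_s).2 /= sz prednK.
Qed.

Lemma window_in_path_ideal q : (q + t <= n)%N ->
  path_ideal (@line_edge n) t ('X_[window q] : {mpoly k[n]}).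
Proof.
move=> q_n; exists 1%N, (fun=> 1), (fun=> 'X_[window q]).
by split=> [_|]; [apply/path_monomial_lineE; exists q | rewrite big_ord1 mul1r].
Qed.

Lemma path_ideal_mcoeff (f : {mpoly k[n]}) m :
    path_ideal (@line_edge n) t f -> f@_m != 0 ->
  exists2 q, (q + t <= n)%N & (window q <= m)%MM.
Proof.
case=> N [c [g [gP ->]]] /mcoeff_sum_neq0 [j _].
have /path_monomial_lineE [q q_n ->] := gP j.
by move/mcoeffMX_neq0; exists q.
Qed.

End PathIdeal.

(** * Long lines: a nonlinear first syzygy *)

Section NonlinearSyzygy.
Variables (k : fieldType) (n t : nat).
Hypotheses (t_gt1 : (1 < t)%N) (n_gt : (t.*2 < n)%N).

Local Notation I := (@path_ideal k n (@line_edge n) t).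
Local Notation m0 := (interval_mnm n 0 t).
Local Notation m1 := (interval_mnm n t.+1 (t.+1 + t)).

(** Besides [m0] itself, the only window dividing x * [m0] for a variable x
    outside [m0] is the one starting at 1, and it needs x = x_t.  For x beyond x_t
    the monomial x * [m0] therefore arises in a product l * f, with l linear and f
    in the ideal, only as x times [m0]. *)
Lemma linear_mcoeff_first (l f : {mpoly k[n]}) (x : 'I_n) :
    l \is 1.-homog -> I f -> (t < x)%N ->
  (l * f)@_(U_(x) + m0) = l@_U_(x) * f@_m0.
Proof.
move=> l_lin If lt_tx; apply: mcoeffM_unique => a b e la fb.
have /eqP := dhomog_mdeg l_lin la; rewrite mdeg_eq1 => /existsP[p /eqP a_p].
apply/eqP; rewrite a_p; apply/eqP; congr (U_(_)%MM); apply/eqP/negPn/negP => ne_px.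
have [q q_n /mnm_lepP le_q] := path_ideal_mcoeff (ltnW t_gt1) If fb.
have eb i : ((x == i) + (i < t) = (p == i) + b i)%N.
  by move/mnmP/(_ i): e; rewrite a_p !mnmDE !mnm1E interval_mnmE.
have inb (i : 'I_n) : (q <= i < q + t)%N -> (0 < b i)%N.
  by move=> qi; move: (le_q i); rewrite interval_mnmE qi.
have bp : b p = 0%N.
  by move: (eb p); rewrite eqxx eq_sym (negbTE ne_px); case: (p < t)%N => /=; lia.
have lt_pt : (p < t)%N.
  by move: (eb p); rewrite eqxx eq_sym (negbTE ne_px); case: (p < t)%N => /=; lia.
have q_p : ~~ (q <= p < q + t)%N by apply/negP => /inb; rewrite bp.
have lt_tn : (t < n)%N by lia.
(* The window q avoids p < t and also t, since b vanishes at both (the latter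
   because x > t); so it starts after t, where b is supported on x alone,
   whereas the window contains both q and q + 1. *)
have lt_tq : (t < q)%N.
  rewrite ltnNge; apply/negP=> le_qt; have /= := inb (Ordinal lt_tn).
  move: (eb (Ordinal lt_tn)); rewrite -!val_eqE /=.
  by case: eqP => [|_]; [lia | rewrite ltnn; lia].
have lt_qn : (q < n)%N by lia.
have lt_q1n : (q.+1 < n)%N by lia.
have := inb (Ordinal lt_qn); have := inb (Ordinal lt_q1n).
move: (eb (Ordinal lt_qn)) (eb (Ordinal lt_q1n)); rewrite -!val_eqE /=.
by case: eqP; case: eqP; lia.
Qed.

Lemma path_ideal_not_linear : ~ has_linear_resolution I.
Proof.
case=> d [_ [[len rk sh D aug _ gD gaug augI ex0 _ _] /= shE]].
have t_gt0 := ltnW t_gt1.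
have augP i : I (aug i ord0).
  by apply/augI; exists (delta_mx ord0 i); rewrite -rowE [LHS]mx11_scalar mxE.
have deg_m0 : mdeg m0 = t by rewrite mdeg_interval ?subn0 //; lia.
have aug_homog i : aug i ord0 \is d.-homog.
  by apply: (graded_map_entry gaug); rewrite shE addn0.
have D_lin i j : D 0%N i j \is 1.-homog.
  by apply: (graded_map_entry (gD 0%N)); rewrite !shE addn0.
have Im0 : I 'X_[m0] by apply: window_in_path_ideal => //; lia.
have Im1 : I 'X_[m1] by apply: window_in_path_ideal => //; lia.
have /augI [u uE] := Im0; have /augI [v vE] := Im1.
have sum_u : \sum_j u ord0 j * aug j ord0 = 'X_[m0].
  by move/matrixP/(_ ord0 ord0): uE; rewrite !mxE eqxx mulr1n.
(* The generators u_j f_j produce m0, so degree d is at most t; each f_j is a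
   combination of multiples of windows, so d is at least t. *)
have d_t : d = t.
  have : 'X_[m0]@_m0 != 0 :> k by rewrite mcoeffX eqxx oner_neq0.
  rewrite -{1}sum_u => /mcoeff_sum_neq0 [j _] /mcoeffM_neq0 [a [b [m0E _ fb]]].
  have deg_b := dhomog_mdeg (aug_homog j) fb.
  have [q q_n le_qb] := path_ideal_mcoeff t_gt0 (augP j) fb.
  apply/eqP; rewrite eqn_leq; apply/andP; split.
    by rewrite -deg_m0 m0E mdegD deg_b leq_addl.
  rewrite -deg_b -(submK le_qb) mdegD mdeg_interval; lia.
pose y := 'X_[m1] *: u - 'X_[m0] *: v.
have /ex0 [w y_w] : y *m aug = 0.
  rewrite mulmxBl -!scalemxAl uE vE; apply/matrixP=> i j.
  by rewrite !mxE !mulrnAr (mulrC 'X_[m0]) subrr.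
(* Pairing with c extracts the m0-components of the generators. *)
pose c : 'cV[{mpoly k[n]}]_(rk 0%N) := \col_j ((aug j ord0)@_m0)%:MP.
have Dc_homog i : (D 0%N *m c) i ord0 \is 1.-homog.
  rewrite mxE; apply: rpred_sum => j _; rewrite mxE mulrC mul_mpolyC.
  exact: rpredZ.
have Dc_coef i (x : 'I_n) : (t < x)%N -> ((D 0%N *m c) i ord0)@_U_(x) = 0.
  move=> lt_tx.
  have : row i (D 0%N) *m aug = 0.
    by apply/ex0; exists (delta_mx ord0 i); rewrite rowE.
  move/matrixP/(_ ord0 ord0)/(congr1 (mcoeff (U_(x) + m0))).
  rewrite !mxE mcoeff0 raddf_sum => <-; rewrite raddf_sum; apply: eq_bigr => j _ /=.
  by rewrite !mxE linear_mcoeff_first // mulrC mcoeffCM mulrC.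
have : (y *m c) ord0 ord0 = \sum_i w ord0 i * (D 0%N *m c) i ord0.
  by rewrite y_w -mulmxA mxE.
move/(congr1 (mcoeff m1)).
rewrite raddf_sum /= [RHS]big1 => [|i _]; last first.
  apply/eqP/negPn/negP=> /mcoeffM_neq0 [a [b [m1E _ Dcb]]].
  have /eqP := dhomog_mdeg (Dc_homog i) Dcb; rewrite mdeg_eq1 => /existsP[x /eqP bx].
  move/mnmP/(_ x): m1E; rewrite interval_mnmE mnmDE bx mnm1E eqxx.
  case: ltnP => [lt_tx _|_]; last by lia.
  by move: Dcb; rewrite bx Dc_coef // eqxx.
rewrite mulmxBl -!scalemxAl 3!mxE [X in _ + X]mxE mcoeffB [X in _ - X](_ : _ = 0).
  rewrite subr0 mulrC -[X in mcoeff X]addm0 mcoeffMX => uc0.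
  suff : ('X_[m0])@_m0 = 0 :> k by apply/eqP; rewrite mcoeffX eqxx oner_neq0.
  rewrite -{1}sum_u -uc0 !raddf_sum; apply: eq_bigr => j _ /=.
  rewrite (mcoeffM_lowest _ (aug_homog j)) ?deg_m0 //.
  by rewrite mxE [in RHS]mulrC mcoeffCM mulrC.
apply/eqP/negPn/negP; rewrite mxE mulrC => /mcoeffMX_neq0 /mnm_lepP.
have n_gt0 : (0 < n)%N by lia.
by move/(_ (Ordinal n_gt0)); rewrite !interval_mnmE /= t_gt0.
Qed.

End NonlinearSyzygy.

(** * Short lines: the linear resolution *)

Section LinearResolution.
Variables (k : fieldType) (n t s : nat).
Hypotheses (t_gt0 : (0 < t)%N) (s_t : (s <= t)%N) (n_eq : n = (s + t)%N).

Local Notation I := (@path_ideal k n (@line_edge n) t).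
Local Notation "''X[' a , b ]" := ('X_[k, interval_mnm n a b])
  (at level 0, format "''X[' a ,  b ]").

Definition windows : 'cV[{mpoly k[n]}]_s.+1 := \col_(i < s.+1) 'X[i, i + t].

Definition window_syzygies : 'M[{mpoly k[n]}]_(s, s.+1) :=
  \matrix_(r, i) ('X[r, r.+1] *+ (i == r.+1 :> nat)
                  - 'X[r + t, (r + t).+1] *+ (i == r :> nat)).

Definition tail_sum (u : 'rV[{mpoly k[n]}]_s.+1) (p : nat) : {mpoly k[n]} :=
  \sum_(i < s.+1 | (p <= i)%N) u ord0 i * 'X[i, i + t].

Lemma tail_sum0 u : tail_sum u 0 = (u *m windows) ord0 ord0.
Proof. by rewrite mxE; apply: eq_bigr => i _; rewrite mxE. Qed.

(** Consecutive tail sums differ by a nonzero monomial times one coordinate. *)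
Lemma tail_sum_eq0 u : (forall p, (p <= s)%N -> tail_sum u p = 0) -> u = 0.
Proof.
move=> u0; apply/rowP=> i; rewrite mxE.
have tail_next : tail_sum u i.+1 = 0.
  have [/u0 //|lt_si] := leqP i.+1 s.
  by rewrite /tail_sum big_pred0 // => j; have := ltn_ord j; lia.
have := u0 i (ltn_ord i); rewrite /tail_sum (bigD1 i) //= -[RHS]tail_next.
move/eqP; rewrite -subr_eq0 -addrA.
rewrite [X in _ + (_ - X)](_ : _ = \sum_(j < s.+1 | (i <= j)%N && (j != i)) u ord0 j * 'X[j, j + t]).
  by rewrite subrr addr0 mulf_eq0 (negbTE (mpolyX_neq0 _ _)) orbF => /eqP.
by apply: eq_bigl => j; rewrite ltn_neqAle eq_sym andbC.
Qed.

(** The syzygy r involves the windows r and r + 1, and its two terms cancel; a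
    tail sum sees exactly one of them only if it starts at r + 1. *)
Lemma tail_sum_syzygies (w : 'rV_s) (p : nat) :
  tail_sum (w *m window_syzygies) p =
  \sum_(r < s | r.+1 == p :> nat) w ord0 r * 'X[r, r + t.+1].
Proof.
have cat_r (r : 'I_s) : 'X[r, r.+1] * 'X[r.+1, r.+1 + t] = 'X[r, r + t.+1].
  by rewrite -mpolyXD -interval_mnm_cat ?addSnnS //; lia.
have cat_l (r : 'I_s) : 'X[r + t, (r + t).+1] * 'X[r, r + t] = 'X[r, r + t.+1].
  by rewrite mulrC -mpolyXD -interval_mnm_cat ?addnS //; lia.
rewrite /tail_sum; under eq_bigr => i _ do rewrite mxE mulr_suml.
rewrite exchange_big [RHS]big_mkcond; apply: eq_bigr => r _ /=.
under eq_bigr => i _ do rewrite mxE -mulrA mulrBl.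
rewrite -mulr_sumr sumrB.
have pick (A : {mpoly k[n]}) (j : nat) : (j < s.+1)%N ->
    \sum_(i < s.+1 | (p <= i)%N) (A *+ (i == j :> nat)) * 'X[i, i + t] =
    (A * 'X[j, j + t]) *+ (p <= j)%N.
  move=> lt_j; rewrite big_mkcond (bigD1 (Ordinal lt_j)) //= eqxx big1 => [|i ne_ij].
    by rewrite addr0 mulr1n; case: leqP.
  by rewrite -(inj_eq val_inj) in ne_ij; rewrite (negbTE ne_ij) mulr0n mul0r if_same.
rewrite !pick ?ltnS ?(ltnW (ltn_ord r)) // cat_r cat_l.
have [<-|ne_p] := eqVneq r.+1 p; first by rewrite leqnn ltnn subr0.
by rewrite (_ : (p <= r.+1)%N = (p <= r)%N) ?subrr ?mulr0 //; lia.
Qed.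

Lemma tail_sum_syzygy (w : 'rV_s) (r : 'I_s) :
  tail_sum (w *m window_syzygies) r.+1 = w ord0 r * 'X[r, r + t.+1].
Proof. by rewrite tail_sum_syzygies (big_pred1 r). Qed.

Lemma syzygies_windows : window_syzygies *m windows = 0.
Proof.
apply/row_matrixP=> r; rewrite row0 row_mul rowE.
apply/rowP=> j; rewrite ord1 -tail_sum0 tail_sum_syzygies big_pred0 ?mxE //.
Qed.

Lemma window_syzygies_inj (w : 'rV_s) : w *m window_syzygies = 0 -> w = 0.
Proof.
move=> w0; apply/rowP=> r; rewrite mxE.
have := tail_sum_syzygy w r; rewrite w0 /tail_sum big1 => [|i _]; last by rewrite mxE mul0r.
by move/esym/eqP; rewrite mulf_eq0 (negbTE (mpolyX_neq0 _ _)) orbF => /eqP.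
Qed.

(** The monomials of the tail sum are multiples of two windows, one on each side
    of the cut between r and r + 1, and [s <= t] leaves no gap between them. *)
Lemma tail_sum_dvd u (r : nat) : tail_sum u 0 = 0 -> (r < s)%N ->
  exists q, tail_sum u r.+1 = q * 'X[r, r + t.+1].
Proof.
move=> u0 lt_rs; apply: mpolyX_dvd => m nz.
have [i lt_ri /mcoeffMX_neq0 /mnm_lepP le_i] := mcoeff_sum_neq0 nz.
have head : tail_sum u r.+1 = - \sum_(i < s.+1 | (i <= r)%N) u ord0 i * 'X[i, i + t].
  apply/eqP; rewrite -addr_eq0 addrC -[X in _ == X]u0 /tail_sum.
  rewrite [X in _ == X](bigID (fun i : 'I_s.+1 => (i <= r)%N)) /=.
  by apply/eqP; congr (_ + _); apply: eq_bigl => j; rewrite ltnNge.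
move: nz; rewrite head mcoeffN oppr_eq0.
case/mcoeff_sum_neq0 => j le_jr /mcoeffMX_neq0 /mnm_lepP le_j.
apply/mnm_lepP => x; move: (le_i x) (le_j x); rewrite !interval_mnmE.
by have := ltn_ord i; lia.
Qed.

(** The tail sums of a syzygy, divided by the words of length t + 1, are its
    coordinates on the rows of [window_syzygies]. *)
Lemma windows_exact (u : 'rV_s.+1) :
  u *m windows = 0 <-> exists w, u = w *m window_syzygies.
Proof.
split=> [u0|[w ->]]; last by rewrite -mulmxA syzygies_windows mulmx0.
have tail_u0 : tail_sum u 0 = 0 by rewrite tail_sum0 u0 mxE.
have /fin_all_exists [q qE] (r : 'I_s) := tail_sum_dvd tail_u0 (ltn_ord r).
exists (\row_r q r); apply/eqP; rewrite -subr_eq0; apply/eqP/tail_sum_eq0 => p le_ps.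
have -> (v : 'rV_s.+1) : tail_sum (u - v) p = tail_sum u p - tail_sum v p.
  by rewrite /tail_sum -sumrB; apply: eq_bigr => i _; rewrite !mxE mulrBl.
case: p le_ps => [_|r lt_rs].
  by rewrite tail_u0 tail_sum_syzygies big_pred0 ?subr0.
by rewrite (qE (Ordinal lt_rs)) (tail_sum_syzygy _ (Ordinal lt_rs)) mxE subrr.
Qed.

Lemma windows_image f : I f <-> exists u : 'rV_s.+1, u *m windows = f%:M.
Proof.
split=> [[N [c [g [gP ->]]]]|[u /matrixP/(_ ord0 ord0)]].
  apply: (big_ind (fun h : {mpoly k[n]} => exists u : 'rV_s.+1, u *m windows = h%:M)).
  - by exists 0; rewrite mul0mx raddf0.
  - by move=> f1 f2 [u1 e1] [u2 e2]; exists (u1 + u2); rewrite mulmxDl e1 e2 raddfD.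
  move=> j _; have /(path_monomial_lineE t_gt0) [q q_n ->] := gP j.
  have lt_q : (q < s.+1)%N by lia.
  exists (c j *: delta_mx ord0 (Ordinal lt_q)).
  by rewrite -scalemxAl -rowE [row _ _]mx11_scalar scale_scalar_mx !mxE.
rewrite [RHS]mxE eqxx mulr1n -tail_sum0 => <-.
exists s.+1, (u ord0), (fun i => 'X[i, i + t]); split=> // i.
by apply/path_monomial_lineE => //; exists i; rewrite // n_eq leq_add2r -ltnS.
Qed.

Lemma path_ideal_linear : has_linear_resolution I.
Proof.
have X_homog a b d : (a <= b <= n)%N -> (b - a = d)%N -> 'X[a, b] \is d.-homog.
  by move=> ab <-; rewrite dhomogX; apply/eqP/mdeg_interval.
have windows_homog i j : windows i j \is t.-homog.
  by rewrite mxE X_homog ?addKn //; have := ltn_ord i; lia.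
have syz_homog i j : window_syzygies i j \is 1.-homog.
  by rewrite mxE; apply: rpredB; apply: rpredMn; apply: X_homog; have := ltn_ord i; lia.
exists t; split.
  exists (path_monomial (@line_edge n) t); split=> // g.
  by move/(path_monomial_lineE t_gt0) => [q q_n ->]; apply: X_homog; lia.
pose rk i := match i with 0 => s.+1 | 1 => s | _ => 0 end%N.
pose D i : 'M[{mpoly k[n]}]_(rk i.+1, rk i) :=
  match i return 'M_(rk i.+1, rk i) with 0%N => window_syzygies | _.+1 => 0 end.
have D_homog i j l : D i j l \is 1.-homog.
  by case: i j l => [|i] j l; [exact: syz_homog | rewrite mxE rpred0].
unshelve eexists.
  apply: (@MinGradedRes k n I 1 rk (fun i _ => (t + i)%N) D windows).
  - by case=> [|[|i]].
  - by move=> i; apply: (homog_graded_map (c := 1)) => //; rewrite addnS addn1.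
  - by apply: (homog_graded_map (c := t)) => //; rewrite addn0.
  - exact: windows_image.
  - exact: windows_exact.
  - case=> [|i] u /=.
      split=> [/window_syzygies_inj ->|[w ->]]; last by rewrite mulmx0 mul0mx.
      by exists 0; rewrite mul0mx.
    by split=> [_|_]; [exists 0; apply/rowP => [[]] | rewrite mulmx0].
  move=> i j l; apply/eqP/negPn/negP => /(dhomog_mdeg (D_homog i j l)).
  by rewrite mdeg0.
by [].
Qed.

End LinearResolution.

Theorem corollary3p5 (k : fieldType) (n t : nat) (ht2 : (2 <= t)%N)
    (htn : (t <= n)%N) :
  has_linear_resolution (@path_ideal k n (@line_edge n) t) <->
  (n%:R / 2%:R <= t%:R :> rat).
Proof.
rewrite ler_pdivrMr ?ltr0n // -natrM ler_nat muln2.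
split=> [lin|le_n]; last by apply: (@path_ideal_linear k n t (n - t)); lia.
by rewrite leqNgt; apply/negP=> lt_n; apply: path_ideal_not_linear lin.
Qed.
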